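(* Let $\Omega$ be a non-empty set, let $\lambda:\Omega\to[0,1]$ be a possibility distribution on $\Omega$, and let $P_\lambda$ be the possibility measure induced by $\lambda$. Let $\delta\in(0,2)$. Suppose that the sequence of functions $X_k:\Omega\to\mathbb{R}$, $k\in\mathbb{N}=\{1,2,\dots\}$, satisfies $$\sup_{n\in\mathbb{N}}\frac{1}{n^\delta}\cdot\max\{Var_{sup}(X_1),\dots,Var_{sup}(X_n)\}=C<+\infty.$$ Denote $M_n(\omega)=\max\{X_1(\omega),\dots,X_n(\omega)\}$, $\omega\in\Omega$. Then $Y_n(\omega):=\frac{M_n(\omega)-E_{sup}(M_n)}{n}$ converges to $0$ as $n\to\infty$, almost everywhere with respect to $P_\lambda$; that is, $$P_\lambda\left(\left\{\omega\in\Omega:\frac{M_n(\omega)-E_{sup}(M_n)}{n}\not\to 0\right\}\right)=0,$$ and also $$P_\lambda\left(\left\{\omega\in\Omega:\lim_{n\to\infty}\frac{M_n(\omega)-E_{sup}(M_n)}{n}=0\right\}\right)=1.$$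
   Context: A possibility distribution on a non-empty set $\Omega$ is a function $\lambda:\Omega\to[0,1]$ with $\sup\{\lambda(s):s\in\Omega\}=1$. It induces the possibility measure $P_\lambda:\mathcal{P}(\Omega)\to[0,1]$ (defined on all subsets of $\Omega$) given by $P_\lambda(A)=\sup\{\lambda(s):s\in A\}$ for $A\subset\Omega$, with $P_\lambda(\emptyset)=0$. For a function $X:\Omega\to\mathbb{R}$, the possibility expectation is $E_{sup}(X)=\sup_{s\in\Omega}X(s)\lambda(s)$, and the possibility variance is $Var_{sup}(X)=\sup\{(X(s)-E_{sup}(X))^2\lambda(s):s\in\Omega\}$. The possibility variance is defined for $X$ with $E_{sup}(X)$ finite, so the assumed bound on $Var_{sup}(X_k)$ is understood to include that each $E_{sup}(X_k)$ is a finite real number. Functions $Y_n:\Omega\to\mathbb{R}$ converge to $Y:\Omega\to\mathbb{R}$ almost everywhere with respect to $P_\lambda$ if $P_\lambda(\{\omega\in\Omega:Y_n(\omega)\not\to Y(\omega)\})=0$, where $Y_n(\omega)\not\to Y(\omega)$ means that $(Y_n(\omega))_n$ either has no limit or has a limit different from $Y(\omega)$. *)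

(* Defs.v *)
From HB Require Import structures.
From mathcomp Require Import all_boot all_order all_algebra.
From mathcomp Require Import all_classical all_reals all_analysis.

Set Implicit Arguments.
Unset Strict Implicit.
Unset Printing Implicit Defensive.

Import Order.TTheory GRing.Theory Num.Theory.
Import numFieldNormedType.Exports.

Local Open Scope classical_set_scope.
Local Open Scope ring_scope.

Definition possibility_distribution (R : realType) (Omega : Type)
    (lambda : Omega -> R) : Prop :=
  (forall s, 0 <= lambda s <= 1) /\ sup (range lambda) = 1.

(* The real-valued [sup] is total with [sup set0 = 0], which gives the required
   value on the empty event; [lambda @` A] is bounded for a distribution. *)
Definition possibility (R : realType) (Omega : Type) (lambda : Omega -> R)
    (A : set Omega) : R :=
  sup (lambda @` A).

Definition Esup (R : realType) (Omega : Type) (lambda : Omega -> R)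
    (X : Omega -> R) : \bar R :=
  ereal_sup (range (fun s => (X s * lambda s)%:E)).

(* Meaningful only when [Esup lambda X] is finite, because of [fine]. *)
Definition Varsup (R : realType) (Omega : Type) (lambda : Omega -> R)
    (X : Omega -> R) : \bar R :=
  ereal_sup (range (fun s => ((X s - fine (Esup lambda X)) ^+ 2 * lambda s)%:E)).

(* max {u 1, ..., u n} for n >= 1. Sequences are indexed from 1, so [u 0] is
   never used; the default element [u 1] only matters for n = 0. *)
Definition running_max (d : Order.disp_t) (T : orderType d) (u : nat -> T)
    (n : nat) : T :=
  \big[Order.max/u 1%N]_(1 <= k < n.+1) u k.

Definition max_fun (R : realType) (Omega : Type) (X : nat -> Omega -> R)
    (n : nat) : Omega -> R :=
  fun w => running_max (fun k => X k w) n.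

Definition centered_max (R : realType) (Omega : Type) (lambda : Omega -> R)
    (X : nat -> Omega -> R) (n : nat) : Omega -> R :=
  fun w => (max_fun X n w - fine (Esup lambda (max_fun X n))) / n%:R.

Definition cvg_ae_possibility (R : realType) (Omega : Type)
    (lambda : Omega -> R) (Y : nat -> Omega -> R) (Y0 : Omega -> R) : Prop :=
  possibility lambda [set w | ~ (Y n w @[n --> \oo] --> Y0 w)] = 0.

(* [fine] is harmless in [centered_max]: the expectation of the maximum is
   finite as soon as each expectation is. *)
Lemma Esup_max_fun_fin_num (R : realType) (Omega : Type) (lambda : Omega -> R)
    (X : nat -> Omega -> R) (n : nat) :
  [set: Omega] !=set0 -> possibility_distribution lambda ->
  (forall k, (1 <= k)%N -> Esup lambda (X k) \is a fin_num) ->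
  Esup lambda (max_fun X n) \is a fin_num.
Proof.
move=> [s0 _] [l01 _] EX.
have l0 s : 0 <= lambda s by have /andP[] := l01 s.
have XE k s : (1 <= k)%N -> X k s * lambda s <= fine (Esup lambda (X k)).
  move=> k1; rewrite -lee_fin fineK; last exact: EX.
  by apply: ereal_sup_ubound; exists s.
pose B := running_max (fun k => fine (Esup lambda (X k))) n.
have MB s : max_fun X n s * lambda s <= B.
  rewrite /B /max_fun /running_max !big_nat.
  elim/big_ind2 : _ => [|a b c e ab ce|k /andP[k1 _]]; [exact: XE| |exact: XE].
  by rewrite maxr_pMl// ge_max !le_max ab ce orbT.
rewrite fin_numE; apply/andP; split; apply/negP => /eqP E.
- have : ((max_fun X n s0 * lambda s0)%:E <= Esup lambda (max_fun X n))%E.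
    by apply: ereal_sup_ubound; exists s0.
  by rewrite E.
- have : (Esup lambda (max_fun X n) <= B%:E)%E.
    by apply: ge_ereal_sup => _ [s _ <-]; rewrite lee_fin.
  by rewrite E.
Qed.

(* Main.v *)
Require Import Defs.
From HB Require Import structures.
From mathcomp Require Import all_boot all_order all_algebra.
From mathcomp Require Import all_classical all_reals all_analysis.
From mathcomp Require Import lra.

Set Implicit Arguments.
Unset Strict Implicit.
Unset Printing Implicit Defensive.

Import Order.TTheory GRing.Theory Num.Theory.
Import numFieldNormedType.Exports.

Local Open Scope classical_set_scope.
Local Open Scope ring_scope.

(** Multiplication by [lambda s >= 0] commutes with maxima and suprema commute
    with each other, so [Esup (max_fun X n)] is exactly the maximum of the
    [Esup (X k)], [k <= n]. The definition of [Varsup] gives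
    [`|X k s - Esup (X k)| <= sqrt (C n ^ delta / lambda s)] for [k <= n] at each
    point [s] with [lambda s > 0], and the maximum is 1-Lipschitz for the sup
    norm, so the same bound holds for [max_fun X n]. As [delta / 2 < 1], dividing
    by [n] gives convergence to 0 at every point outside [lambda = 0]. *)

(** The default elements [u 1] and [v 1] are related too because [1 <= n], so the induction needs no
    neutral element for the maximum. Letting the two orders differ allows reals to be compared with
    extended reals. *)
Lemma running_max_rel2 (d1 d2 : Order.disp_t) (T1 : orderType d1)
    (T2 : orderType d2) (K : T1 -> T2 -> Prop) (u : nat -> T1) (v : nat -> T2)
    (n : nat) :
  (forall x1 x2 y1 y2, K x1 x2 -> K y1 y2 ->
    K (Order.max x1 y1) (Order.max x2 y2)) ->
  (1 <= n)%N -> (forall k, (1 <= k <= n)%N -> K (u k) (v k)) ->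
  K (running_max u n) (running_max v n).
Proof.
move=> Kmax n1 Kuv; rewrite /running_max !big_nat.
by elim/big_ind2 : _ => [|x1 x2 y1 y2|k]; [exact: Kuv|exact: Kmax|exact: Kuv].
Qed.

Lemma le_running_max (d : Order.disp_t) (T : orderType d) (u : nat -> T)
    (k n : nat) :
  (1 <= k <= n)%N -> (u k <= running_max u n)%O.
Proof.
by move=> kn; rewrite /running_max le_bigmax_seq// mem_index_iota ltnS.
Qed.

Lemma running_max_le (d : Order.disp_t) (T : orderType d) (u : nat -> T)
    (n : nat) (z : T) :
  (1 <= n)%N -> (forall k, (1 <= k <= n)%N -> (u k <= z)%O) ->
  (running_max u n <= z)%O.
Proof.
move=> n1 uz; rewrite /running_max big_nat.
by apply: bigmax_le => [|k]; exact: uz.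
Qed.

Lemma dist_running_max_le (R : realDomainType) (u v : nat -> R) (r : R)
    (n : nat) :
  (1 <= n)%N -> (forall k, (1 <= k <= n)%N -> `|u k - v k| <= r) ->
  `|running_max u n - running_max v n| <= r.
Proof.
apply: (@running_max_rel2 _ _ _ _ (fun x y => `|x - y| <= r)).
move=> x1 x2 y1 y2; rewrite !ler_distl => /andP[? ?] /andP[? ?].
by case: (leP x1 y1) => ?; case: (leP x2 y2) => ?; apply/andP; split; lra.
Qed.

Lemma Esup_max_fun (R : realType) (Omega : Type) (lambda : Omega -> R)
    (X : nat -> Omega -> R) (n : nat) :
  (forall s, 0 <= lambda s) -> (1 <= n)%N ->
  Esup lambda (max_fun X n) = running_max (fun k => Esup lambda (X k)) n.
Proof.
move=> l0 n1; apply/eqP; rewrite eq_le; apply/andP; split.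
  apply: ge_ereal_sup => _ [s _ <-].
  (* At a fixed [s], the relation [x * lambda s <= e] survives taking maxima on both sides because
     [0 <= lambda s]. *)
  apply: (@running_max_rel2 _ _ _ _
    (fun x e => ((x * lambda s)%:E <= e)%E)) => // [x1 x2 y1 y2 xe ye|k _].
    by rewrite maxr_pMl// EFin_max ge_max !le_max xe ye orbT.
  by apply: ereal_sup_ubound; exists s.
apply: running_max_le => // k kn; apply: ge_ereal_sup => _ [s _ <-].
apply: (@le_trans _ _ (max_fun X n s * lambda s)%:E); last first.
  by apply: ereal_sup_ubound; exists s.
by rewrite lee_fin ler_wpM2r// /max_fun (le_running_max (fun k => X k s)).
Qed.

(** [fine] sends infinite values to 0 and so is not monotone. With finite terms, the maximum passes
    instead through the embedding of the reals, which preserves order. *)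
Lemma fine_running_max (R : realType) (u : nat -> \bar R) (n : nat) :
  (1 <= n)%N -> (forall k, (1 <= k)%N -> u k \is a fin_num) ->
  fine (running_max u n) = running_max (fun k => fine (u k)) n.
Proof.
move=> n1 ufin.
suff -> : running_max u n = (running_max (fine \o u) n)%:E by [].
apply: (@running_max_rel2 _ _ _ _ (fun e x => e = x%:E)) => //.
  by move=> _ x _ y -> ->; rewrite EFin_max.
by move=> k /andP[k1 _]; rewrite fineK// ufin.
Qed.

Lemma dist_fine_Esup_le (R : realType) (Omega : Type) (lambda : Omega -> R)
    (X : Omega -> R) (B : R) (s : Omega) :
  0 < lambda s -> (Varsup lambda X <= B%:E)%E ->
  `|X s - fine (Esup lambda X)| <= Num.sqrt (B / lambda s).
Proof.
move=> ls VB.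
have XB : (X s - fine (Esup lambda X)) ^+ 2 <= B / lambda s.
  rewrite ler_pdivlMr// -lee_fin; apply: le_trans VB.
  by apply: ereal_sup_ubound; exists s.
(* The comparison of square roots asks for [0 <= B / lambda s], which holds because a square lies
   below it. *)
by rewrite -sqrtr_sqr ler_sqrt// (le_trans _ XB)// sqr_ge0.
Qed.

(** Shifting the index by one turns the sequence into the power [c] of [harmonic], which is positive
    and tends to 0; the power function tends to 0 at 0 from the right. *)
Lemma cvg_powRN_natr (R : realType) (c : R) :
  0 < c -> (n%:R : R) `^ (- c) @[n --> \oo] --> (0 : R).
Proof.
move=> c0; rewrite -cvg_shiftS.
rewrite (_ : [sequence _]_n = (fun n => harmonic n `^ c)); last first.
  by apply/funext => n /=; rewrite powRN -powR_inv1 ?powR_ge0// -powRrM mulrC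
    powRrM powR_inv1.
have /cvg_at_rightP := powR_cvg0 c0; apply; split => [n|].
  exact: harmonic_gt0.
exact: cvg_harmonic.
Qed.

Lemma possibility_null (R : realType) (Omega : Type) (lambda : Omega -> R)
    (A : set Omega) :
  (forall s, A s -> lambda s = 0) -> possibility lambda A = 0.
Proof.
move=> A0; rewrite /possibility; have [->|A_neq0] := eqVneq A set0.
  by rewrite image_set0 sup0.
have /set0P[s As] := A_neq0.
suff -> : lambda @` A = [set 0] by rewrite sup1.
apply/seteqP; split => [_ [w Aw <-]|_ ->] /=; first exact: A0.
by exists s => //; exact: A0.
Qed.

Lemma possibility_full (R : realType) (Omega : Type) (lambda : Omega -> R)
    (A : set Omega) :
  possibility_distribution lambda -> (forall s, 0 < lambda s -> A s) ->
  possibility lambda A = 1.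
Proof.
move=> [l01 lsup] lA.
have [s0 ls0] : exists s, 0 < lambda s.
  (* If [lambda] were positive nowhere, its supremum would be 0 instead of 1. *)
  apply: contrapT => /forallNP nl; have : (1 : R) != 0 by exact: oner_neq0.
  rewrite -lsup -/(possibility lambda setT) possibility_null ?eqxx//.
  move=> s _; apply/eqP; rewrite eq_le leNgt.
  apply/andP; split; first exact/negP.
  by have /andP[] := l01 s.
have lub : has_ubound (lambda @` A).
  by exists 1 => _ [s _ <-]; have /andP[] := l01 s.
apply/eqP; rewrite eq_le; apply/andP; split.
  apply: ge_sup; first by exists (lambda s0), s0 => //; exact: lA.
  by move=> _ [s _ <-]; have /andP[] := l01 s.
rewrite -lsup; apply: ge_sup; first by exists (lambda s0), s0.
(* A point that may lie outside [A] has [lambda s <= 0] and is dominated by [s0], which belongs to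
   [A]. *)
move=> _ [s _ <-]; have [ls|ls] := ltP 0 (lambda s).
  by apply: ub_le_sup => //; exists s => //; exact: lA.
apply: (le_trans ls); apply: le_trans (ltW ls0) _.
by apply: ub_le_sup => //; exists s0 => //; exact: lA.
Qed.

Theorem theorem3p4 (R : realType) (Omega : Type) (lambda : Omega -> R)
    (delta C : R) (X : nat -> Omega -> R)
    (Omega_nonempty : [set: Omega] !=set0)
    (lambda_distr : possibility_distribution lambda)
    (delta_range : 0 < delta < 2)
    (E_finite : forall k : nat, (1 <= k)%N -> Esup lambda (X k) \is a fin_num)
    (Var_bound :
      ereal_sup [set ((1 / n%:R `^ delta)%:E *
                      running_max (fun k => Varsup lambda (X k)) n)%E
                | n in [set n : nat | (1 <= n)%N]] = C%:E) :
  cvg_ae_possibility lambda (centered_max lambda X) (fun _ => 0) /\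
  possibility lambda
    [set w | centered_max lambda X n w @[n --> \oo] --> 0] = 1.
Proof.
have [l01 _] := lambda_distr.
have l0 s : 0 <= lambda s by have /andP[] := l01 s.
have VarB n k : (1 <= k <= n)%N ->
    (Varsup lambda (X k) <= (C * n%:R `^ delta)%:E)%E.
  move=> kn; have n1 : (1 <= n)%N by case/andP: kn; exact: leq_trans.
  apply: le_trans (le_running_max (fun k => Varsup lambda (X k)) kn) _.
  rewrite mulrC EFinM -lee_pdivrMl ?powR_gt0 ?ltr0n// -Var_bound -div1r.
  by apply: ereal_sup_ubound; exists n.
have Ycvg s : 0 < lambda s -> centered_max lambda X n s @[n --> \oo] --> 0.
  move=> ls; apply: norm_cvg0.
  (* The deviation grows at most like the power [delta / 2] of [n]; division by [n] leaves the
     exponent [- c], negative since [delta < 2]. *)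
  pose c := 1 - delta / 2.
  have c0 : 0 < c by rewrite /c; lra.
  have bcvg : Num.sqrt (C / lambda s) * n%:R `^ (- c) @[n --> \oo] --> (0 : R).
    rewrite -[X in _ --> X](mulr0 (Num.sqrt (C / lambda s))).
    exact: cvgMr (cvg_powRN_natr c0).
  apply: squeeze_cvgr (cvg_cst 0) bcvg.
  near=> n.
  have n1 : (1 <= n)%N by near: n; exact: nbhs_infty_gt.
  (* The numerator becomes a difference of two running maxima of real sequences, ready for the
     Lipschitz bound. *)
  rewrite normr_ge0/= /centered_max Esup_max_fun// fine_running_max//.
  rewrite normrM normfV [`|n%:R|]ger0_norm//.
  have n0 : 0 < n%:R :> R by rewrite ltr0n.
  rewrite ler_pdivrMr//.
  have -> : Num.sqrt (C / lambda s) * n%:R `^ (- c) * n%:R =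
      Num.sqrt (C * n%:R `^ delta / lambda s).
    rewrite [in RHS]mulrAC [in RHS]mulrC [in RHS]sqrtrM ?powR_ge0//.
    rewrite -(powR12_sqrt (powR_ge0 _ _)) -powRrM -mulrA mulrC; congr (_ * _).
    (* The factor [n] is written as a power with exponent 1; exponents add as [n] is nonzero, and
       [1 - c = delta / 2]. *)
    rewrite -[X in _ * X]powRr1 ?ltW// -powRD; last first.
      by rewrite (gt_eqF n0) implybT.
    by congr (_ `^ _); rewrite /c; lra.
  apply: (@dist_running_max_le _ (fun k => X k s)) => // k kn.
  by apply: dist_fine_Esup_le => //; exact: VarB.
split.
- apply: possibility_null => s /= Ys; apply: contra_notP Ys => /eqP ls.
  by apply: Ycvg; rewrite lt_def ls l0.
- exact: possibility_full.
Unshelve. all: by end_near.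
Qed.
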